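(* Let $\underline{\varsigma}^l_{k,i}$ and $\overline{\varsigma}^l_{k,i}$ be the earliest and latest departure times of the MAV assigned to trip $k$ from stop $i$ of line $l$ (precomputed from the data as in the context). The following constraints are valid for the TT-VS-DCA model, i.e. every feasible solution of the model satisfies, for all $l\in\mathcal{L}$, $k\in\mathcal{K}_l$, $i\in\mathcal{S}_l$ and integers $t\in\mathcal{T}$, $$z^l_{k,i,t}=\begin{cases}0, & \text{if } \dfrac{\overline{\varsigma}^l_{k,i}}{\Delta}\le t\le |\mathcal{T}|,\\[2mm] 1, & \text{if } 1\le t\le \dfrac{\underline{\varsigma}^l_{k,i}}{\Delta}-1.\end{cases}$$
   Context: **Sets.** $\mathcal L$: finite set of bus lines. Line $l$ has stops $\mathcal S_l=\{1,\dots,|\mathcal S_l|\}$ in order of travel, partitioned into transfer stops $\mathcal R_l$ and non-transfer stops $\hat{\mathcal R}_l$, and trips $\mathcal K_l=\{1,\dots,|\mathcal K_l|\}$. $\dot{\mathcal A}$: set of transfer corridors $g=(l,i,l',i')$ with $l\neq l'$, $i\in\mathcal R_l$, $i'\in\mathcal R_{l'}$; $g'=(l',i',l,i)$ is the reverse corridor. $\mathcal M$: depots; $FL_m$ (resp. $LL_m$): lines starting (resp. ending) at depot $m$. $\mathcal T=\{1,\dots,|\mathcal T|\}$: time intervals of length $\Delta>0$. $\mathcal W$: finite set of scenarios with probabilities $\rho_w$. $\mathcal P_w$: passenger groups in scenario $w$; group $p$ has $n_p$ passengers, arrival time $u_p$ at its origin stop $i^o_p$, an ordered sequence of lines $\mathcal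 L_p=(l_0,l_1,\dots)$ and an ordered sequence $\mathcal R_p$ of transfer corridors linking consecutive lines. $\mathcal{PO}_i$, $\mathcal{PD}_i$: groups boarding / alighting at stop $i$ (of the line in question). $\mathcal Q=\{1,\dots,|\mathcal Q|\}$: possible numbers of modular units (MAUs) composing a modular vehicle (MAV); each trip is executed by one MAV. **Parameters.** $o^l_{k,1}$: originally scheduled arrival time of trip $k$ at the first stop of $l$; $r^l_{k,i}$: running time from stop $i$ to $i+1$; bounds $\alpha^{min}_{l,k}\le\alpha^{max}_{l,k}$ (shifting time), $\beta^{min}_{l,k,i}\le\beta^{max}_{l,k,i}$ (dwell time), $0\le h^l_{min}\le h^l_{max}$ (headway); $\underline\theta_g\le\overline\theta_g$: minimum/maximum transfer time; $t^{pre}_m$: preparation time at depot $m$; $\mathrm{CAP}$: capacity of one MAU; $\mathrm B$: number of available MAUs; $M_1,M_2,M_3$: big positive constants; $\epsilon_1,\epsilon_2$: tiny positive constants. **Variables.** Binary: $z^l_{k,i,t}$ ($=1$ iff trip $k$ on line $l$ has not yet departed from stop $i$ at time $t$), $\xi^l_{p,k}(w)$, $\chi^l_{p,k}(w)$, $\pi^g_{k,k'}$, $\zeta^g_{p,k,k'}(w)$, $e^g_{k,k'}$, $h^g_{k,k'}(w)$, $y^l_{k,i,q}(w)$. Nonnegative integers: $x^l_{k,i}(w)$ (number of MAUs of the MAV of trip $k$ between stops $i$ and $i+1$), $\kappa_m$. Dependent: $\alpha^l_{k,1},\beta^l_{k,i},a^l_{k,i},d^l_{k,i}$ (shift, dwell,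 arrival, departure times), $b,c,v$ (boarding, alighting, in-vehicle passengers), $AV_{m,t}(w),DV_{m,t}(w)$. Conventions: $\xi^l_{p,0}=0$, $\pi^g_{k,0}=0$, and $z^l_{k,i,t}=1$ for $t\le 0$. **Model (TT-VS-DCA).** A feasible solution is an assignment of all variables satisfying, for all relevant indices: Timetable: $z^l_{k,i,t+1}\le z^l_{k,i,t}$; $d^l_{k,i}=\Delta(1+\sum_{t\in\mathcal T}z^l_{k,i,t})$; $a^l_{k,1}=o^l_{k,1}+\alpha^l_{k,1}$ and $a^l_{k,i}=d^l_{k,i-1}+r^l_{k,i-1}$ for $i\ge2$; $\beta^l_{k,i}=d^l_{k,i}-a^l_{k,i}$; $\alpha^{min}_{l,k}\le\alpha^l_{k,1}\le\alpha^{max}_{l,k}$; $\beta^{min}_{l,k,i}\le\beta^l_{k,i}\le\beta^{max}_{l,k,i}$; $h^l_{min}\le d^l_{k+1,i}-d^l_{k,i}\le h^l_{max}$. Passengers: $M_1(\xi^l_{p,k}(w)-1)\le d^l_{k,i^o_p}-u_p\le M_1\xi^l_{p,k}(w)-\epsilon_1$ for $l=l_0\in\mathcal L_p$; $M_2(\pi^g_{k,k'}-1)\le d^{l'}_{k',i'}-a^l_{k,i}-\underline\theta_g\le M_2\pi^g_{k,k'}-\epsilon_2$ for $g=(l,i,l',i')$; $\zeta^g_{p,k,k'}(w)=\chi^l_{p,k}(w)(\pi^g_{k,k'}-\pi^g_{k,k'-1})$ for $g\in\mathcal R_p$; $\chi^l_{p,k}(w)=\xi^l_{p,k}(w)-\xi^l_{p,k-1}(w)$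 if $l=l_0$, and $\chi^l_{p,k}(w)=\sum_{k'\in\mathcal K_{l'}}\zeta^g_{p,k',k}(w)$ if $l\ne l_0$, with $g=(l',i',l,i)\in\mathcal R_p$; $b^l_{k,i}(w)=\sum_{p\in\mathcal{PO}_i}n_p\chi^l_{p,k}(w)$; $c^l_{k,i}(w)=\sum_{p\in\mathcal{PD}_i}n_p\chi^l_{p,k}(w)$; $v^l_{k,i}(w)=\sum_{j\le i}(b^l_{k,j}(w)-c^l_{k,j}(w))$; $v^l_{k,i}(w)\le \mathrm{CAP}\,x^l_{k,i}(w)$. Vehicle scheduling: $\sum_m\kappa_m\le \mathrm B$; $DV_{m,t}(w)\le\kappa_m+AV_{m,t}(w)$; $AV_{m,t}(w)=\sum_{l\in LL_m}\sum_{k\in\mathcal K_l}(1-z^l_{k,|\mathcal S_l|,t-t^{pre}_m})x^l_{k,|\mathcal S_l|}(w)$; $DV_{m,t}(w)=\sum_{l\in FL_m}\sum_{k\in\mathcal K_l}(1-z^l_{k,1,t})x^l_{k,1}(w)$. Capacity allocation: $e^g_{k,k'}=1$ if $\underline\theta_g\le d^{l'}_{k',i'}-a^l_{k,i}\le\overline\theta_g$ and $0$ otherwise; $h^g_{k,k'}(w)\le e^g_{k,k'}$; $h^g_{k,k'}(w)+h^{g'}_{k',k}(w)\le1$; $x^l_{k,i}(w)=\sum_{q\in\mathcal Q}q\,y^l_{k,i,q}(w)$; $x^l_{k,i-1}(w)=x^l_{k,i}(w)$ for $i\in\hat{\mathcal R}_l$ ($i\ge2$); for $i\in\mathcal R_l$: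 $x^l_{k,i}(w)-x^l_{k,i-1}(w)+1\le M_3(1-h^g_{k,k'}(w))$ and $x^l_{k,i}(w)=x^l_{k,i-1}(w)+\sum_{l'}\sum_{k'\in\mathcal K_{l'}}(h^{g'}_{k',k}(w)-h^g_{k,k'}(w))(x^{l'}_{k',i'-1}(w)-x^{l'}_{k',i'}(w))$, with $g=(l,i,l',i')$. **Earliest/latest departure times.** $\underline\varsigma^l_{k,i}=o^l_{k,1}+\alpha^{min}_{l,k}+\sum_{j=1}^{i}\beta^{min}_{l,k,j}+\sum_{j=1}^{i-1}r^l_{k,j}$ and $\overline\varsigma^l_{k,i}=o^l_{k,1}+\alpha^{max}_{l,k}+\sum_{j=1}^{i}\beta^{max}_{l,k,j}+\sum_{j=1}^{i-1}r^l_{k,j}$. *)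

(* Defs.v *)
From mathcomp Require Import all_boot all_order all_algebra.

Set Implicit Arguments.
Unset Strict Implicit.
Unset Printing Implicit Defensive.

Import Order.TTheory GRing.Theory Num.Theory.
Local Open Scope ring_scope.

(** Plain MathComp.  Stops, trips, time intervals and numbers of modular units
    (MAUs) are the 1-based ranges of the model, so quantities indexed by them
    are functions on [nat] whose values outside the ranges are irrelevant,
    unless a convention (index 0, times [t <= 0]) fixes them. *)

(** [((l, i), (l', i'))] is the corridor from stop [i] of line [l] to stop
    [i'] of line [l']. *)
Definition corridor (L : Type) : Type := ((L * nat) * (L * nat))%type.

Definition reverse (L : Type) (g : corridor L) : corridor L := (g.2, g.1).

Record instance (R : realFieldType) := Instance {
  line : finType;
  nstops : line -> nat;
  transfer : line -> pred nat;
  ntrips : line -> nat;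
  corridors : pred (corridor line);
  depot : finType;
  starting : depot -> {set line};
  ending : depot -> {set line};
  ntimes : nat;
  Delta : R;
  scenario : finType;
  rho : scenario -> R;
  group : scenario -> finType;
  npass : forall w, group w -> nat;
  arrival_time : forall w, group w -> R;
  origin_stop : forall w, group w -> nat;
  destination_stop : forall w, group w -> nat;
  (* The sequence of lines of a group is [first_line p :: next_lines p]. *)
  first_line : forall w, group w -> line;
  next_lines : forall w, group w -> seq line;
  path_corridors : forall w, group w -> seq (corridor line);
  nunits : nat;
  o_first : line -> nat -> R;
  running : line -> nat -> nat -> R;
  alpha_min : line -> nat -> R;
  alpha_max : line -> nat -> R;
  beta_min : line -> nat -> nat -> R;
  beta_max : line -> nat -> nat -> R;
  h_min : line -> R;
  h_max : line -> R;
  theta_min : corridor line -> R;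
  theta_max : corridor line -> R;
  (* Expressed as a number of time intervals, since it shifts a time index. *)
  t_pre : depot -> nat;
  CAP : R;
  B_avail : nat;
  M1 : R;
  M2 : R;
  M3 : R;
  eps1 : R;
  eps2 : R
}.

Arguments npass {R i w}.
Arguments arrival_time {R i w}.
Arguments origin_stop {R i w}.
Arguments destination_stop {R i w}.
Arguments first_line {R i w}.
Arguments next_lines {R i w}.
Arguments path_corridors {R i w}.

Section Ranges.
Variables (R : realFieldType) (D : instance R).

Definition is_stop (l : line D) (i : nat) : bool := (1 <= i <= nstops l)%N.
Definition is_trip (l : line D) (k : nat) : bool := (1 <= k <= ntrips l)%N.
Definition is_time (t : nat) : bool := (1 <= t <= ntimes D)%N.

Definition path_lines (w : scenario D) (p : group w) : seq (line D) :=
  first_line p :: next_lines p.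

Definition boards (w : scenario D) (l : line D) (i : nat) : pred (group w) :=
  fun p => ((l == first_line p) && (i == origin_stop p))
        || ((l, i) \in [seq g.2 | g <- path_corridors p]).

Definition alights (w : scenario D) (l : line D) (i : nat) : pred (group w) :=
  fun p => ((l == last (first_line p) (next_lines p))
              && (i == destination_stop p))
        || ((l, i) \in [seq g.1 | g <- path_corridors p]).

Definition earliest (l : line D) (k i : nat) : R :=
  o_first l k + alpha_min l k + \sum_(1 <= j < i.+1) beta_min l k j
  + \sum_(1 <= j < i) running l k j.

Definition latest (l : line D) (k i : nat) : R :=
  o_first l k + alpha_max l k + \sum_(1 <= j < i.+1) beta_max l k j
  + \sum_(1 <= j < i) running l k j.

End Ranges.

Record well_formed (R : realFieldType) (D : instance R) : Prop := WellFormed {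
  wf_transfer : forall (l : line D) i, transfer l i -> is_stop l i;
  wf_corridors : forall (l l' : line D) i i', corridors ((l, i), (l', i')) ->
    [/\ l != l', transfer l i & transfer l' i'];
  wf_Delta : 0 < Delta D;
  wf_rho_ge0 : forall w : scenario D, 0 <= rho w;
  wf_rho_sum : \sum_(w : scenario D) rho w = 1;
  wf_origin : forall (w : scenario D) (p : group w),
    is_stop (first_line p) (origin_stop p);
  wf_destination : forall (w : scenario D) (p : group w),
    is_stop (last (first_line p) (next_lines p)) (destination_stop p);
  wf_path_mem : forall (w : scenario D) (p : group w),
    all (@corridors R D) (path_corridors p);
  (* The corridors link consecutive lines: the j-th one leaves the j-th line
     and enters the next one. *)
  wf_path_from : forall (w : scenario D) (p : group w),
    [seq g.1.1 | g <- path_corridors p] = belast (first_line p) (next_lines p);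
  wf_path_to : forall (w : scenario D) (p : group w),
    [seq g.2.1 | g <- path_corridors p] = next_lines p;
  wf_alpha : forall (l : line D) k, is_trip l k ->
    alpha_min l k <= alpha_max l k;
  wf_beta : forall (l : line D) k i, is_trip l k -> is_stop l i ->
    beta_min l k i <= beta_max l k i;
  wf_headway : forall l : line D, 0 <= h_min l <= h_max l;
  wf_theta : forall g : corridor (line D), corridors g ->
    theta_min g <= theta_max g;
  wf_M : [/\ 0 < M1 D, 0 < M2 D & 0 < M3 D];
  wf_eps : 0 < eps1 D /\ 0 < eps2 D
}.

(** Corridor-indexed variables take the trip of [g.1.1] first and the trip of
    [g.2.1] second. *)
Record assignment (R : realFieldType) (D : instance R) := Assignment {
  z : line D -> nat -> nat -> int -> bool;
  xi : forall w : scenario D, group w -> line D -> nat -> bool;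
  chi : forall w : scenario D, group w -> line D -> nat -> bool;
  pi : corridor (line D) -> nat -> nat -> bool;
  zeta : forall w : scenario D,
    group w -> corridor (line D) -> nat -> nat -> bool;
  e : corridor (line D) -> nat -> nat -> bool;
  h : scenario D -> corridor (line D) -> nat -> nat -> bool;
  y : scenario D -> line D -> nat -> nat -> nat -> bool;
  x : scenario D -> line D -> nat -> nat -> nat;
  kappa : depot D -> nat;
  alpha : line D -> nat -> R;
  beta : line D -> nat -> nat -> R;
  arr : line D -> nat -> nat -> R;
  dep : line D -> nat -> nat -> R;
  board : scenario D -> line D -> nat -> nat -> R;
  alight : scenario D -> line D -> nat -> nat -> R;
  load : scenario D -> line D -> nat -> nat -> R;
  AV : scenario D -> depot D -> nat -> nat;
  DV : scenario D -> depot D -> nat -> nat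
}.

Arguments xi {R D} _ {w}.
Arguments chi {R D} _ {w}.
Arguments zeta {R D} _ {w}.

Section Model.
Variables (R : realFieldType) (D : instance R) (s : assignment D).

Record timetable_constraints : Prop := TimetableConstraints {
  z_convention : forall (l : line D) k i (t : int),
    is_trip l k -> is_stop l i -> t <= 0 -> z s l k i t = 1%N :> nat;
  z_mono : forall (l : line D) k i (t : nat),
    is_trip l k -> is_stop l i -> is_time D t -> is_time D t.+1 ->
    (z s l k i t.+1 <= z s l k i t)%N;
  dep_def : forall (l : line D) k i, is_trip l k -> is_stop l i ->
    dep s l k i
      = Delta D * (1 + \sum_(1 <= t < (ntimes D).+1) (z s l k i t)%:R);
  arr_first : forall (l : line D) k, is_trip l k -> is_stop l 1 ->
    arr s l k 1 = o_first l k + alpha s l k;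
  arr_next : forall (l : line D) k i,
    is_trip l k -> is_stop l i -> (2 <= i)%N ->
    arr s l k i = dep s l k i.-1 + running l k i.-1;
  beta_def : forall (l : line D) k i, is_trip l k -> is_stop l i ->
    beta s l k i = dep s l k i - arr s l k i;
  alpha_bounds : forall (l : line D) k, is_trip l k ->
    alpha_min l k <= alpha s l k <= alpha_max l k;
  beta_bounds : forall (l : line D) k i, is_trip l k -> is_stop l i ->
    beta_min l k i <= beta s l k i <= beta_max l k i;
  headway : forall (l : line D) k i,
    is_trip l k -> is_trip l k.+1 -> is_stop l i ->
    h_min l <= dep s l k.+1 i - dep s l k i <= h_max l
}.

Record passenger_constraints : Prop := PassengerConstraints {
  xi_convention : forall (w : scenario D) (p : group w),
    xi s p (first_line p) 0 = 0%N :> nat;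
  pi_convention : forall (g : corridor (line D)) k,
    corridors g -> is_trip g.1.1 k -> pi s g k 0 = 0%N :> nat;
  xi_def : forall (w : scenario D) (p : group w) k (l := first_line p),
    is_trip l k ->
    M1 D * ((xi s p l k)%:R - 1)
      <= dep s l k (origin_stop p) - arrival_time p
      <= M1 D * (xi s p l k)%:R - eps1 D;
  pi_def : forall (l l' : line D) i i' k k' (g := ((l, i), (l', i'))),
    corridors g -> is_trip l k -> is_trip l' k' ->
    M2 D * ((pi s g k k')%:R - 1)
      <= dep s l' k' i' - arr s l k i - theta_min g
      <= M2 D * (pi s g k k')%:R - eps2 D;
  zeta_def : forall (w : scenario D) (p : group w) (l l' : line D) i i' k k'
      (g := ((l, i), (l', i'))),
    g \in path_corridors p -> is_trip l k -> is_trip l' k' ->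
    (zeta s p g k k')%:R
      = (chi s p l k)%:R * ((pi s g k k')%:R - (pi s g k k'.-1)%:R) :> R;
  chi_first : forall (w : scenario D) (p : group w) k (l := first_line p),
    is_trip l k ->
    (chi s p l k)%:R = (xi s p l k)%:R - (xi s p l k.-1)%:R :> R;
  chi_next : forall (w : scenario D) (p : group w) (l l' : line D) i i' k
      (g := ((l', i'), (l, i))),
    l != first_line p -> g \in path_corridors p -> is_trip l k ->
    chi s p l k = (\sum_(1 <= k' < (ntrips l').+1) zeta s p g k' k)%N :> nat;
  board_def : forall w (l : line D) k i, is_trip l k -> is_stop l i ->
    board s w l k i
      = \sum_(p : group w | boards l i p) (npass p)%:R * (chi s p l k)%:R;
  alight_def : forall w (l : line D) k i, is_trip l k -> is_stop l i ->
    alight s w l k i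
      = \sum_(p : group w | alights l i p) (npass p)%:R * (chi s p l k)%:R;
  load_def : forall w (l : line D) k i, is_trip l k -> is_stop l i ->
    load s w l k i
      = \sum_(1 <= j < i.+1) (board s w l k j - alight s w l k j);
  capacity : forall w (l : line D) k i, is_trip l k -> is_stop l i ->
    load s w l k i <= CAP D * (x s w l k i)%:R
}.

Record scheduling_constraints : Prop := SchedulingConstraints {
  fleet : (\sum_(m : depot D) kappa s m <= B_avail D)%N;
  depot_balance : forall w m t, is_time D t ->
    (DV s w m t <= kappa s m + AV s w m t)%N;
  (* The subtraction [t - t_pre m] is in [int]. *)
  AV_def : forall w m t, is_time D t ->
    AV s w m t
      = (\sum_(l in ending m) \sum_(1 <= k < (ntrips l).+1)
           (1 - z s l k (nstops l) (t%:Z - (t_pre m)%:Z)%R)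
           * x s w l k (nstops l))%N;
  DV_def : forall w m t, is_time D t ->
    DV s w m t
      = (\sum_(l in starting m) \sum_(1 <= k < (ntrips l).+1)
           (1 - z s l k 1 t%:Z) * x s w l k 1)%N
}.

(** Constraints and summands mentioning the number of MAUs on the segment
    before a stop are restricted to stops other than the first one, which has
    no preceding segment. *)
Record allocation_constraints : Prop := AllocationConstraints {
  e_def : forall (l l' : line D) i i' k k' (g := ((l, i), (l', i'))),
    corridors g -> is_trip l k -> is_trip l' k' ->
    e s g k k'
      = (theta_min g <= dep s l' k' i' - arr s l k i <= theta_max g);
  h_le_e : forall w (g : corridor (line D)) k k',
    corridors g -> is_trip g.1.1 k -> is_trip g.2.1 k' ->
    (h s w g k k' <= e s g k k')%N;
  h_one_way : forall w (g : corridor (line D)) k k',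
    corridors g -> is_trip g.1.1 k -> is_trip g.2.1 k' ->
    (h s w g k k' + h s w (reverse g) k' k <= 1)%N;
  x_def : forall w (l : line D) k i, is_trip l k -> is_stop l i ->
    x s w l k i = (\sum_(1 <= q < (nunits D).+1) q * y s w l k i q)%N;
  x_non_transfer : forall w (l : line D) k i,
    is_trip l k -> is_stop l i -> ~~ transfer l i -> (2 <= i)%N ->
    x s w l k i.-1 = x s w l k i;
  x_donor : forall w (l l' : line D) i i' k k' (g := ((l, i), (l', i'))),
    corridors g -> is_trip l k -> is_trip l' k' -> (2 <= i)%N ->
    (x s w l k i)%:R - (x s w l k i.-1)%:R + 1
      <= M3 D * (1 - (h s w g k k')%:R);
  x_transfer : forall w (l : line D) k i,
    is_trip l k -> transfer l i -> (2 <= i)%N ->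
    (x s w l k i)%:Z
      = (x s w l k i.-1)%:Z
        + \sum_(l' : line D)
          \sum_(2 <= i' < (nstops l').+1 | corridors ((l, i), (l', i')))
          \sum_(1 <= k' < (ntrips l').+1)
            let g := ((l, i), (l', i')) in
            ((h s w (reverse g) k' k)%:Z - (h s w g k k')%:Z)
            * ((x s w l' k' i'.-1)%:Z - (x s w l' k' i')%:Z)
}.

Definition feasible : Prop :=
  [/\ timetable_constraints, passenger_constraints,
      scheduling_constraints & allocation_constraints].

End Model.

(* Main.v *)
Require Import Defs.
From mathcomp Require Import all_boot all_order all_algebra.
Import Order.TTheory GRing.Theory Num.Theory.
Local Open Scope ring_scope.

(** Two independent facts meet in the theorem.

    Adding up the timetable equations along a line telescopes: a departure time
    is the scheduled start plus the shift, all dwell times and all running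
    times so far ([dep_unroll]).  Bounding the shift and the dwell times
    termwise puts every departure time between [earliest] and [latest]
    ([dep_window]).

    On the other hand, the departure time is [Delta * (1 + N)], where [N] counts
    the intervals [t] at which [z] equals 1.  As [z] is nonincreasing in [t],
    these intervals form an initial segment, so [z] is 1 at [t] exactly when
    [t <= N] ([count_ge], [count_lt]).  Hence if [z] is 1 at [t] the departure
    is no earlier than [Delta * (t + 1)], and if [z] is 0 at [t] it is no later
    than [Delta * t].  The first contradicts a latest departure of at most
    [Delta * t], the second an earliest departure of at least
    [Delta * (t + 1)]; positivity of [Delta] makes both strict. *)

Section InitialSegment.
Variables (n : nat) (f : nat -> bool).
Hypothesis f_noninc :
  forall t, (1 <= t)%N -> (t < n)%N -> (f t.+1 <= f t)%N.

Lemma noninc_le t u : (1 <= t)%N -> (t <= u)%N -> (u <= n)%N -> f u -> f t.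
Proof.
move=> t_gt0; elim: u => [|u IHu]; first by rewrite leqn0 => /eqP->.
rewrite leq_eqVlt => /predU1P[->//|lt_tu] lt_un fu1.
apply: IHu => //; first exact: ltnW.
by move: (f_noninc u (leq_trans t_gt0 lt_tu) lt_un); rewrite fu1; case: (f u).
Qed.

(** The first [t] terms are all 1, since [f] can only fall from 1 to 0. *)
Lemma count_ge t : (1 <= t <= n)%N -> f t ->
  (t <= \sum_(1 <= u < n.+1) f u)%N.
Proof.
case/andP=> t_gt0 le_tn ft.
rewrite (big_cat_nat _ (n := t.+1)) //=; apply: leq_trans (leq_addr _ _).
rewrite (eq_big_nat _ _ (F2 := fun=> 1%N)).
  by rewrite sum_nat_const_nat muln1 subn1.
move=> u /andP[u_gt0 le_ut].
by rewrite (noninc_le _ _ u_gt0 le_ut le_tn ft).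
Qed.

(** Once [f] is 0 it stays 0, so only the [t - 1] terms before [t] can
    contribute. *)
Lemma count_lt t : (1 <= t <= n)%N -> ~~ f t ->
  (\sum_(1 <= u < n.+1) f u < t)%N.
Proof.
case/andP=> t_gt0 le_tn nft.
rewrite (big_cat_nat _ (n := t)) //=; last exact: leqW.
rewrite [X in (_ + X)%N]big_nat_cond [X in (_ + X)%N]big1 ?addn0.
  rewrite -[X in (_ < X)%N](prednK t_gt0) ltnS -subn1 -[(t - 1)%N]muln1.
  by rewrite -sum_nat_const_nat; apply: leq_sum => u _; apply: leq_b1.
move=> u /andP[/andP[le_tu lt_un] _]; apply/eqP; rewrite eqb0.
by apply: contra nft; apply: noninc_le.
Qed.

End InitialSegment.

Section DepartureWindow.
Variables (R : realFieldType) (D : instance R) (s : assignment D).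
Hypothesis tt : timetable_constraints s.

(** Each departure is the previous departure plus one running time and one dwell
    time, because the dwell time is the departure minus the arrival. *)
Lemma dep_unroll (l : line D) k i : is_trip l k -> is_stop l i ->
  dep s l k i = o_first l k + alpha s l k
    + \sum_(1 <= j < i.+1) beta s l k j + \sum_(1 <= j < i) running l k j.
Proof.
move=> trip_k; elim: i => [//|[|i] IHi] stop_i.
  rewrite big_nat1 big_geq // addr0.
  by rewrite (beta_def tt) // (arr_first tt) // subrKC.
have stop_i' : is_stop l i.+1 by case/andP: stop_i => _ /ltnW.
rewrite big_nat_recr //= [\sum_(1 <= j < i.+2) running l k j]big_nat_recr //=.
rewrite [_ + (_ + beta _ _ _ _)]addrA addrACA -IHi // (beta_def tt) //.
by rewrite (arr_next tt) //= [RHS]addrCA subrK.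
Qed.

Lemma dep_window (l : line D) k i : is_trip l k -> is_stop l i ->
  earliest l k i <= dep s l k i <= latest l k i.
Proof.
move=> trip_k stop_i; rewrite dep_unroll // /earliest /latest.
have [alpha_lo alpha_hi] := andP (alpha_bounds tt trip_k).
have betaP j : (1 <= j < i.+1)%N ->
    beta_min l k j <= beta s l k j <= beta_max l k j.
  case/andP=> j_gt0 le_ji; apply: (beta_bounds tt) => //.
  by case/andP: stop_i => _; rewrite /is_stop j_gt0; apply: leq_trans.
rewrite !lerD2r; apply/andP; split; apply: lerD; rewrite ?lerD2l //.
  by apply: ler_sum_nat => j /betaP/andP[].
by apply: ler_sum_nat => j /betaP/andP[].
Qed.

End DepartureWindow.

Theorem proposition1 (R : realFieldType) (D : instance R) (s : assignment D) :
  well_formed D -> feasible s ->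
  forall (l : line D) (k i t : nat),
    is_trip l k -> is_stop l i -> is_time D t ->
    (latest l k i / Delta D <= (t%:R : R) <= (ntimes D)%:R ->
       z s l k i t = 0%N :> nat) /\
    (1 <= (t%:R : R) <= earliest l k i / Delta D - 1 ->
       z s l k i t = 1%N :> nat).
Proof.
move=> wfD [tt _ _ _] l k i t trip_k stop_i time_t.
have Delta_gt0 := wf_Delta wfD.
have [dep_lo dep_hi] := andP (dep_window _ _ _ tt _ _ _ trip_k stop_i).
have z_noninc u : (1 <= u)%N -> (u < ntimes D)%N ->
    (z s l k i u.+1 <= z s l k i u)%N.
  move=> u_gt0 lt_u; apply: (z_mono tt trip_k stop_i).
    by apply/andP; split=> //; apply: ltnW.
  by apply/andP.
move: dep_lo dep_hi; rewrite (dep_def tt) // -natr_sum -mulrS => dep_lo dep_hi.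
split=> /andP[].
  rewrite ler_pdivrMr // mulrC => late _; apply/eqP; rewrite eqb0.
  apply/negP => zt; have := le_trans dep_hi late.
  by rewrite ler_pM2l // ler_nat leqNgt ltnS (count_ge _ _ z_noninc).
move=> _; rewrite lerBrDr ler_pdivlMr // mulrC natr1 => early.
apply/eqP; rewrite eqb1; apply/negPn/negP => nzt.
have := le_trans early dep_lo; rewrite ler_pM2l // ler_nat ltnS leqNgt.
by rewrite (count_lt _ _ z_noninc).
Qed.
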